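(* Let $G_p$ and $G_c$ be IF-OFP systems with passivity indices $(\nu_p,\rho_p)$ and $(\nu_c,\rho_c)$ respectively, $\nu_p,\rho_p,\nu_c,\rho_c\in\mathbb{R}$, interconnected in the controller-side event-triggered feedback loop described in the context, where the event instants $t_k$ are determined by the triggering condition $\|e_c(t)\|_2^2>\delta\|y_c(t)\|_2^2$ with $\delta\in(0,1]$. Put $w(t)=\begin{bmatrix} w_1(t)\\ w_2(t)\end{bmatrix}$, $y(t)=\begin{bmatrix} y_p(t)\\ y_c(t)\end{bmatrix}$. Then the event-triggered networked control system is QSR-dissipative with respect to the inputs $w$ and outputs $y$, and satisfies $$\dot V(t)\le w^T(t)Rw(t)+2w^T(t)Sy(t)+y^T(t)Qy(t)$$ for a storage function $V$ of the interconnection, where $$S=\begin{bmatrix}\tfrac12 I&\nu_p I\\-\nu_c I&\tfrac12 I\end{bmatrix},\quad R=\begin{bmatrix}-(\nu_p-|\nu_p|) I&0\\0&-\nu_cI\end{bmatrix},\quad Q=\begin{bmatrix}-(\rho_p+\nu_c-\tfrac14)I&0\\0&-\beta(\nu_p)I\end{bmatrix}$$ and $$\beta(\nu_p)=\begin{cases}\rho_c-\nu_p-\delta(1+\nu_p)&\text{if }\nu_p>0,\\ \rho_c-\delta&\text{if }\nu_p=0,\\ \rho_c+2\nu_p-\delta(1-3\nu_p)&\text{if }\nu_p<0.\end{cases}$$ Additionally, if $Q<0$, that is, $\beta(\nu_p)>0$ and $\rho_p+\nu_c-\tfrac14>0$, then the interconnection is (finite gain) $L_2$-stable from $w$ to 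$y$.
   Context: Systems: a system $G$ has the form $\dot x=f(x,u)$, $y=h(x,u)$ with state $x\in X\subset\mathbb{R}^n$ and $u(t),y(t)\in\mathbb{R}^m$. A storage function is a nonnegative function $V$ of the state; it is taken differentiable, and $\dot V(t)$ is the time derivative along solutions. $G$ is IF-OFP (input feed-forward output feedback passive) with input passivity index $\nu\in\mathbb{R}$ and output passivity index $\rho\in\mathbb{R}$ (of either sign) if there is a storage function $V$ with $\dot V\le u^Ty-\rho y^Ty-\nu u^Tu$ for all $t$ along all solutions. Controller-side event-triggered loop: $G_p$ (plant, state $x_p$, input $u_p$, output $y_p$) has indices $(\nu_p,\rho_p)$, and $G_c$ (controller, state $x_c$, input $u_c$, output $y_c$) has indices $(\nu_c,\rho_c)$; all inputs and outputs are $\mathbb{R}^m$-valued. External signals $w_1,w_2$ are $\mathbb{R}^m$-valued. At event instants $t_k$ the controller output is sampled and sent to the plant, and is held constant until the next event. For $t\in[t_k,t_{k+1})$: $u_c(t)=w_2(t)+y_p(t)$, $u_p(t)=w_1(t)-y_c(t_k)$, $e_c(t)=y_c(t)-y_c(t_k)$ (so $u_p=w_1+e_c-y_c$). A new event is triggered as soon as $\|e_c(t)\|_2^2>\delta\|y_c(t)\|_2^2$ (Euclidean norm of the vectors at time $t$), so that $e_c^T(t)e_c(t)\le\delta\, y_c^T(t)y_c(t)$ holds at all times. A storage function of the interconnection is a nonnegative function $V$ of $(x_p,x_c)$; inequalities on $\dot V$ are required along all solutions for all $t$ in the intervals $[t_k,t_{k+1})$. A system with input $w$ and output $y$ is QSR-dissipative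 if there is a storage function $V$ with $\dot V\le y^TQy+2y^TSw+w^TRw$ (dissipative with a quadratic supply rate, up to transposing $S$), with $Q,S,R$ constant matrices and $Q,R$ symmetric. It is finite gain $L_2$-stable if there are a positive semidefinite function $V$ of the state and a constant $\gamma>0$ such that $V(t_1)-V(0)\le\int_0^{t_1}(\gamma^2w^Tw-y^Ty)\,dt$ for all inputs and all $t_1>0$. $I$ is the $m\times m$ identity. *)

(* Defs.v *)
From HB Require Import structures.
From mathcomp Require Import all_boot all_order all_algebra.
From mathcomp Require Import all_classical all_reals all_analysis.
Set Implicit Arguments.
Unset Strict Implicit.
Unset Printing Implicit Defensive.
Import Order.TTheory GRing.Theory Num.Theory.
Import numFieldNormedType.Exports.
Local Open Scope classical_set_scope.
Local Open Scope ring_scope.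

Definition dot (R : realType) n (u v : 'cV[R]_n) : R :=
  (u^T *m v) ord0 ord0.

(* The norm that the library puts on 'cV[R]_n is the sup norm. *)
Definition norm2 (R : realType) n (v : 'cV[R]_n) : R := Num.sqrt (dot v v).

Definition negdef (R : realType) n (Q : 'M[R]_n) : Prop :=
  forall z : 'cV[R]_n, z != 0 -> dot z (Q *m z) < 0.

(* The half-open interval [a, b[ of real times, where b may be +oo. *)
Definition span_co (R : realType) (a : R) (b : \bar R) : set R :=
  [set t | a <= t /\ (t%:E < b)%E].

(* Time derivatives are right derivatives. Where the signal is differentiable
   this is the ordinary derivative; at the instants where an input jumps, such
   as the left end of [t_k, t_(k+1)[, only the right derivative exists. *)
Definition is_rderive (R : realType) (V : normedModType R)
    (f : R -> V) (t : R) (l : V) : Prop :=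
  h^-1 *: (f (t + h) - f t) @[h --> 0^'+] --> l.

(* An input/state/output system given by its solutions: [trajectory G T w x y]
   says that (w, x, y) is a solution on [0, T[. *)
Record io_system (R : realType) (q n p : nat) := IOSystem {
  states : set 'cV[R]_n;
  trajectory : \bar R -> (R -> 'cV[R]_q) -> (R -> 'cV[R]_n) ->
               (R -> 'cV[R]_p) -> Prop }.

Definition storage (R : realType) q n p (G : io_system R q n p)
    (V : 'cV[R]_n -> R) : Prop :=
  forall x, states G x -> 0 <= V x /\ differentiable V x.

Definition dissipative_with (R : realType) q n p (G : io_system R q n p)
    (supply : 'cV[R]_q -> 'cV[R]_p -> R) (V : 'cV[R]_n -> R) : Prop :=
  storage G V /\
  forall T w x y, trajectory G T w x y ->
  forall t, span_co 0 T t ->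
  exists2 dV : R, is_rderive (V \o x) t dV & dV <= supply (w t) (y t).

Definition IF_OFP (R : realType) m n (nu rho : R) (G : io_system R m n m) :
    Prop :=
  exists V, dissipative_with G
    (fun u y => dot u y - rho * dot y y - nu * dot u u) V.

Definition QSR_dissipative (R : realType) q n p (Q : 'M[R]_p) (S : 'M[R]_(p, q))
    (W : 'M[R]_q) (G : io_system R q n p) : Prop :=
  [/\ Q^T = Q, W^T = W &
      exists V, dissipative_with G
        (fun w y => dot y (Q *m y) + 2 * dot y (S *m w) + dot w (W *m w)) V].

Definition measurable_signal (R : realType) q (D : set R) (w : R -> 'cV[R]_q) :
    Prop :=
  forall i, measurable_fun D (fun t => w t i ord0).

(* The inputs are the locally square integrable ones. Nothing is assumed on the
   size of the output: the integrand is bounded above by an integrable function,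
   so its integral is meaningful, and it is -oo if y is not square integrable
   on [0, t1]. *)
Definition L2_stable (R : realType) q n p (G : io_system R q n p) : Prop :=
  exists (V : 'cV[R]_n -> R) (gamma : R),
  [/\ forall x, states G x -> 0 <= V x, 0 < gamma &
      forall T w x y, trajectory G T w x y ->
      measurable_signal (span_co 0 T) w -> measurable_signal (span_co 0 T) y ->
      forall t1 : R, 0 < t1 -> (t1%:E < T)%E ->
      lebesgue_measure.-integrable `[0, t1] (fun t : R => (dot (w t) (w t))%:E) ->
      ((V (x t1) - V (x 0))%:E <=
        \int[lebesgue_measure]_(t in `[0%R, t1])
           (gamma ^+ 2 * dot (w t) (w t) - dot (y t) (y t))%:E)%E].

(* x' = f(x, u), y = h(x, u), with x in X. *)
Record system (R : realType) (n m : nat) := System {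
  sys_X : set 'cV[R]_n;
  sys_f : 'cV[R]_n -> 'cV[R]_m -> 'cV[R]_n;
  sys_h : 'cV[R]_n -> 'cV[R]_m -> 'cV[R]_m }.

Definition solution (R : realType) n m (G : system R n m) (a : R) (b : \bar R)
    (u : R -> 'cV[R]_m) (x : R -> 'cV[R]_n) (y : R -> 'cV[R]_m) : Prop :=
  {within span_co a b, continuous x} /\
  forall t, span_co a b t ->
    [/\ sys_X G (x t), is_rderive x t (sys_f G (x t) (u t))
      & y t = sys_h G (x t) (u t)].

Definition io_of (R : realType) n m (G : system R n m) : io_system R m n m :=
  IOSystem (sys_X G) (solution G 0).

(* The loop run from time a up to b with the plant receiving the held value yk
   of the controller output. *)
Definition held_loop (R : realType) np nc m (Gp : system R np m)
    (Gc : system R nc m) (w1 w2 : R -> 'cV[R]_m) (yk : 'cV[R]_m)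
    (a : R) (b : \bar R)
    (xp : R -> 'cV[R]_np) (xc : R -> 'cV[R]_nc) (yp yc : R -> 'cV[R]_m) : Prop :=
  solution Gp a b (fun t => w1 t - yk) xp yp /\
  solution Gc a b (fun t => w2 t + yp t) xc yc.

(* [s] is the event instant following the event instant [a]: the first time (as
   an infimum, +oo if there is none) at which the triggering condition holds
   along the loop run on from [a] with the sample [yc a] held. This loop agrees
   with the actual trajectory on [a, s[, and has to be run beyond [s], up to
   some [b], because the strict triggering condition need not hold at [s]
   itself; at [s] the actual trajectory switches to the new sample. *)
Definition next_event (R : realType) np nc m (delta : R) (Gp : system R np m)
    (Gc : system R nc m) (T : \bar R) (w1 w2 : R -> 'cV[R]_m)
    (xp : R -> 'cV[R]_np) (xc : R -> 'cV[R]_nc) (yp yc : R -> 'cV[R]_m)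
    (a : R) (s : \bar R) : Prop :=
  exists (b : \bar R) (xp' : R -> 'cV[R]_np) (xc' : R -> 'cV[R]_nc)
         (yp' yc' : R -> 'cV[R]_m),
  let ec' t := yc' t - yc a in
  [/\ held_loop Gp Gc w1 w2 (yc a) a b xp' xc' yp' yc',
      (Order.min T s <= b)%E,
      forall t, span_co a (Order.min T s) t ->
        [/\ xp' t = xp t, xc' t = xc t, yp' t = yp t & yc' t = yc t]
    & s = ereal_inf [set t%:E | t in
            [set t | span_co a b t /\
                     delta * norm2 (yc' t) ^+ 2 < norm2 (ec' t) ^+ 2]]].

(* [tk] is the sequence of event instants; tk k = +oo from some k on if there
   are finitely many events. That every time of [0, T[ lies in some
   [tk k, tk k.+1[ excludes accumulation of events before T. *)
Definition event_triggered_solution (R : realType) np nc m (delta : R)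
    (Gp : system R np m) (Gc : system R nc m) (T : \bar R)
    (w1 w2 : R -> 'cV[R]_m) (xp : R -> 'cV[R]_np) (xc : R -> 'cV[R]_nc)
    (yp yc : R -> 'cV[R]_m) : Prop :=
  exists (tk : nat -> \bar R) (up uc : R -> 'cV[R]_m),
  [/\ tk 0%N = 0%E,
      nondecreasing_seq tk,
      forall t, span_co 0 T t -> exists k, (tk k <= t%:E < tk k.+1)%E,
      solution Gp 0 T up xp yp /\ solution Gc 0 T uc xc yc
    & forall k a, tk k = a%:E -> (a%:E < T)%E ->
        (forall t, span_co a (Order.min T (tk k.+1)) t ->
           uc t = w2 t + yp t /\ up t = w1 t - yc a) /\
        next_event delta Gp Gc T w1 w2 xp xc yp yc a (tk k.+1)].

(* Input (w1, w2), state (xp, xc) and output (yp, yc), stacked. *)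
Definition event_triggered_loop (R : realType) np nc m (delta : R)
    (Gp : system R np m) (Gc : system R nc m) :
    io_system R (m + m) (np + nc) (m + m) :=
  IOSystem
    [set x | sys_X Gp (usubmx x) /\ sys_X Gc (dsubmx x)]
    (fun T w x y =>
       event_triggered_solution delta Gp Gc T
         (fun t => usubmx (w t)) (fun t => dsubmx (w t))
         (fun t => usubmx (x t)) (fun t => dsubmx (x t))
         (fun t => usubmx (y t)) (fun t => dsubmx (y t))).

Definition beta (R : realType) (nu_p rho_c delta : R) : R :=
  if 0 < nu_p then rho_c - nu_p - delta * (1 + nu_p)
  else if nu_p == 0 then rho_c - delta
  else rho_c + 2 * nu_p - delta * (1 - 3 * nu_p).

Definition Smx (R : realType) m (nu_p nu_c : R) : 'M[R]_(m + m) :=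
  block_mx (1 / 2)%:M nu_p%:M (- nu_c)%:M (1 / 2)%:M.

Definition Rmx (R : realType) m (nu_p nu_c : R) : 'M[R]_(m + m) :=
  block_mx (- (nu_p - `|nu_p|))%:M 0 0 (- nu_c)%:M.

Definition Qmx (R : realType) m (nu_p rho_p nu_c rho_c delta : R) :
    'M[R]_(m + m) :=
  block_mx (- (rho_p + nu_c - 1 / 4))%:M 0 0 (- beta nu_p rho_c delta)%:M.

(* Main.v *)
Require Import Defs.
From HB Require Import structures.
From mathcomp Require Import all_boot all_order all_algebra.
From mathcomp Require Import all_classical all_reals all_analysis.
From mathcomp Require Import measurable_realfun ring lra.
Import Order.TTheory GRing.Theory Num.Theory.
Import numFieldNormedType.Exports.
Local Open Scope classical_set_scope.
Local Open Scope ring_scope.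

(** The storage function of the loop is the sum [Vp + Vc] of those of the plant
    and of the controller.

    Dissipativity is a pointwise matter. At each time the sampling error
    [e = yc - yc(t_k)] satisfies [|e|^2 <= delta * |yc|^2], because the next
    event is the first time at which this fails ([held_sample_error]).
    Substituting [up = w1 + e - yc] and [uc = w2 + yp] in the two supply rates,
    the claimed quadratic form exceeds their sum by
    [|nu_p| |w1|^2 + 1/4 |yp|^2 - <e, yp> + (rho_c - beta) |yc|^2
     + nu_p (|e|^2 + |yc|^2 + 2 <w1, e> - 2 <e, yc>)],
    which the bound on [|e|^2] turns, in each of the three sign cases of [nu_p],
    into a sum of squares ([loop_supply_le]).

    For L2 stability, Young's inequality absorbs the cross terms into the
    negative definite [Q], so that the supply is at most
    [c * |w|^2 - eps * |y|^2] ([loop_supply_strict]). It remains to integrate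
    this differential inequality. The storage is only known to be continuous
    along trajectories, with a right derivative bounded by a measurable function
    [g] that may be unbounded and, a priori, of integral [-oo], so neither the
    mean value theorem nor the fundamental theorem of calculus applies.
    [rderive_le_integral] does it in the manner of Vitali and Caratheodory: a
    nonnegative [g] is majorized, at an arbitrarily small cost in the integral,
    by some [h] that stays above [g t] in a neighbourhood of every [t]
    ([open_majorant]); the increments of the storage are then dominated by those
    of the integral of [h] to the right of each time, hence everywhere
    ([le_integral_majorant]); and truncating [g] from below removes the sign
    condition by monotone convergence, which also shows that the output is
    square integrable. *)

Section passive_loop.
Set Implicit Arguments.
Unset Strict Implicit.
Context {R : realType}.
Notation mu := (@lebesgue_measure R).

(** * The inner product *)

Lemma dotE n (u v : 'cV[R]_n) : dot u v = \sum_i u i ord0 * v i ord0.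
Proof. by rewrite /dot mxE; apply: eq_bigr => i _; rewrite mxE. Qed.

Lemma dotC n (u v : 'cV[R]_n) : dot u v = dot v u.
Proof. by rewrite !dotE; apply: eq_bigr => i _; rewrite mulrC. Qed.

Lemma dotDl n (u v z : 'cV[R]_n) : dot (u + v) z = dot u z + dot v z.
Proof. by rewrite /dot linearD mulmxDl mxE. Qed.

Lemma dotDr n (u v z : 'cV[R]_n) : dot z (u + v) = dot z u + dot z v.
Proof. by rewrite /dot mulmxDr mxE. Qed.

Lemma dotZl n a (u z : 'cV[R]_n) : dot (a *: u) z = a * dot u z.
Proof. by rewrite /dot linearZ -scalemxAl mxE. Qed.

Lemma dotZr n a (u z : 'cV[R]_n) : dot z (a *: u) = a * dot z u.
Proof. by rewrite dotC dotZl dotC. Qed.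

Lemma dotNl n (u z : 'cV[R]_n) : dot (- u) z = - dot u z.
Proof. by rewrite -scaleN1r dotZl mulN1r. Qed.

Lemma dotNr n (u z : 'cV[R]_n) : dot z (- u) = - dot z u.
Proof. by rewrite dotC dotNl dotC. Qed.

Lemma dot0 n (u : 'cV[R]_n) : dot u 0 = 0.
Proof. by rewrite /dot mulmx0 mxE. Qed.

Definition dot_expand := (dotDl, dotDr, dotNl, dotNr, dotZl, dotZr).

Lemma dot_ge0 n (u : 'cV[R]_n) : 0 <= dot u u.
Proof. by rewrite dotE; apply: sumr_ge0 => i _; rewrite -expr2 sqr_ge0. Qed.

Lemma dot_gt0 n (u : 'cV[R]_n) : u != 0 -> 0 < dot u u.
Proof.
move=> u0; rewrite lt_neqAle dot_ge0 andbT eq_sym; apply: contra_neq u0.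
rewrite dotE => /eqP; rewrite psumr_eq0 => [/allP u0|i _]; last first.
  by rewrite -expr2 sqr_ge0.
apply/matrixP => i j; rewrite ord1 mxE.
by have := u0 i (mem_index_enum i); rewrite -expr2 sqrf_eq0 => /eqP.
Qed.

Lemma norm2_sqr n (u : 'cV[R]_n) : norm2 u ^+ 2 = dot u u.
Proof. by rewrite /norm2 sqr_sqrtr ?dot_ge0. Qed.

Lemma dot_trmx q p (S : 'M[R]_(p, q)) (u : 'cV[R]_q) (v : 'cV[R]_p) :
  dot u (S^T *m v) = dot v (S *m u).
Proof. by rewrite dotC /dot trmx_mul trmxK -mulmxA. Qed.

Lemma dot_vsubmx n1 n2 (u v : 'cV[R]_(n1 + n2)) :
  dot u v = dot (usubmx u) (usubmx v) + dot (dsubmx u) (dsubmx v).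
Proof.
by rewrite /dot -{1}(vsubmxK u) -{1}(vsubmxK v) tr_col_mx mul_row_col mxE.
Qed.

Lemma dot_block_scalar m (a b c d : R) (u v : 'cV[R]_(m + m)) :
  dot u (block_mx a%:M b%:M c%:M d%:M *m v) =
  a * dot (usubmx u) (usubmx v) + b * dot (usubmx u) (dsubmx v) +
  (c * dot (dsubmx u) (usubmx v) + d * dot (dsubmx u) (dsubmx v)).
Proof.
rewrite dot_vsubmx -{1 2}(vsubmxK v) mul_block_col col_mxKu col_mxKd.
by rewrite !mul_scalar_mx !dot_expand.
Qed.

(** Young's inequality, with the weight [c] on the second vector; it is the
    nonnegativity of [|c v - k u|^2], with room to spare. *)
Lemma dot_young n (c k : R) (u v : 'cV[R]_n) : 0 < c ->
  k * dot u v <= c * dot v v + k ^+ 2 / c * dot u u.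
Proof.
move=> c0; have c0' : c != 0 by rewrite gt_eqF.
have := dot_ge0 (c *: v - k *: u); rewrite !dot_expand (dotC v u) => H.
have Hv := dot_ge0 v; have Hu := dot_ge0 u.
rewrite -(ler_pM2l c0) mulrDr [X in _ + X]mulrA.
have -> : c * (k ^+ 2 / c) = k ^+ 2 by field.
nra.
Qed.

(** * The supply rate of the loop *)

Lemma loop_supplyE m (nu_p rho_p nu_c rho_c delta : R) (w y : 'cV[R]_(m + m)) :
  dot w (Rmx m nu_p nu_c *m w) + 2 * dot w (Smx m nu_p nu_c *m y) +
  dot y (Qmx m nu_p rho_p nu_c rho_c delta *m y) =
  let: (w1, w2) := (usubmx w, dsubmx w) in
  let: (yp, yc) := (usubmx y, dsubmx y) in
  (- (nu_p - `|nu_p|) * dot w1 w1 - nu_c * dot w2 w2) +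
  2 * (1 / 2 * dot w1 yp + nu_p * dot w1 yc - nu_c * dot w2 yp +
       1 / 2 * dot w2 yc) +
  (- (rho_p + nu_c - 1 / 4) * dot yp yp - beta nu_p rho_c delta * dot yc yc).
Proof.
rewrite /Rmx /Smx /Qmx -(raddf0 (@scalar_mx R m)) !dot_block_scalar; ring.
Qed.

(** The algebraic core of the dissipation inequality. With [n = |nu_p|], the
    bound on [e] is used with the weight [1 + n] if [nu_p > 0] and [1 + 3 * n]
    if [nu_p < 0]: these are the factors of [delta] in [beta], chosen so that
    what remains is a sum of squares. *)
Lemma loop_supply_le m (nu_p rho_p nu_c rho_c delta : R)
    (w1 w2 yp yc e : 'cV[R]_m) : dot e e <= delta * dot yc yc ->
  let up := w1 + e - yc in let uc := w2 + yp in
  (dot up yp - rho_p * dot yp yp - nu_p * dot up up) +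
  (dot uc yc - rho_c * dot yc yc - nu_c * dot uc uc) <=
  (- (nu_p - `|nu_p|) * dot w1 w1 - nu_c * dot w2 w2) +
  2 * (1 / 2 * dot w1 yp + nu_p * dot w1 yc - nu_c * dot w2 yp +
       1 / 2 * dot w2 yc) +
  (- (rho_p + nu_c - 1 / 4) * dot yp yp - beta nu_p rho_c delta * dot yc yc).
Proof.
move=> ee /=; rewrite !dot_expand.
rewrite (dotC e w1) (dotC yc w1) (dotC yc e) (dotC yp w2) (dotC yc yp).
(* The 1/4 in [Q] is the cost of the cross term [dot e yp]. *)
have := dot_ge0 (2^-1 *: yp - e); rewrite !dot_expand (dotC yp e) => Hpe.
have Hyc := dot_ge0 yc.
rewrite /beta; case: ltrgt0P => nu0.
(* For [nu_p > 0] the slack contains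
   [nu_p * (|w1 + e|^2 + |yc - e|^2 + |yc|^2)]. *)
- have := dot_ge0 (w1 + e); have := dot_ge0 (yc - e).
  rewrite !dot_expand (dotC e w1) (dotC yc e) => H1 H2.
  have K1 := mulr_ge0 (ltW nu0) H1; have K2 := mulr_ge0 (ltW nu0) H2.
  have K3 := mulr_ge0 (ltW nu0) Hyc.
  have K4 : nu_p * dot e e <= nu_p * (delta * dot yc yc) by rewrite ler_pM2l.
  by lra.
(* For [nu_p < 0] the slack contains [- nu_p * (|w1 - e|^2 + |yc + e|^2)]. *)
- have := dot_ge0 (w1 - e); have := dot_ge0 (yc + e).
  rewrite !dot_expand (dotC e w1) (dotC yc e) => H1 H2.
  have nu0' : 0 <= - nu_p by lra.
  have K1 := mulr_ge0 nu0' H1; have K2 := mulr_ge0 nu0' H2.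
  have K4 : - nu_p * dot e e <= - nu_p * (delta * dot yc yc)
    by rewrite ler_wpM2l.
  by lra.
- by rewrite nu0; lra.
Qed.

(** Test vectors supported in one of the two blocks recover the two scalars;
    [m > 0] provides a nonzero one. *)
Lemma negdef_Qmx m (nu_p rho_p nu_c rho_c delta : R) : (0 < m)%N ->
  negdef (Qmx m nu_p rho_p nu_c rho_c delta) <->
  (0 < beta nu_p rho_c delta /\ 0 < rho_p + nu_c - 1 / 4).
Proof.
move=> m0; set b := beta _ _ _; set a := _ - 1 / 4.
have QE z : dot z (Qmx m nu_p rho_p nu_c rho_c delta *m z) =
    - (a * dot (usubmx z) (usubmx z) + b * dot (dsubmx z) (dsubmx z)).
  rewrite /Qmx -(raddf0 (@scalar_mx R m)) dot_block_scalar -/a -/b; ring.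
split=> [N|[b0 a0] z z0].
- pose e : 'cV[R]_m := delta_mx (Ordinal m0) 0.
  have e0 : e != 0.
    by apply/eqP => /matrixP/(_ (Ordinal m0) ord0); rewrite !mxE !eqxx/=;
      apply/eqP; rewrite oner_eq0.
  have ee := dot_gt0 e0.
  have c0 (x y : 'cV[R]_m) : (x != 0) || (y != 0) -> col_mx x y != 0.
    by move=> xy; rewrite col_mx_eq0 negb_and.
  split.
  + have := N (col_mx 0 e); rewrite c0 ?e0 ?orbT// QE col_mxKu col_mxKd.
    rewrite dot0 => /(_ isT); nra.
  + have := N (col_mx e 0); rewrite c0 ?e0// QE col_mxKu col_mxKd.
    rewrite dot0 => /(_ isT); nra.
rewrite QE oppr_lt0.
have : (usubmx z != 0) || (dsubmx z != 0).
  by rewrite -negb_and -col_mx_eq0 vsubmxK.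
have U := dot_ge0 (usubmx z); have D := dot_ge0 (dsubmx z).
by case/orP => /dot_gt0 ?; [apply: ltr_pwDl|apply: ltr_wpDl];
  rewrite ?mulr_gt0// mulr_ge0// ltW.
Qed.

(** A negative definite [Q] absorbs the cross terms between inputs and outputs,
    at the price of a multiple of [|w|^2]. *)
Lemma loop_supply_strict m (nu_p rho_p nu_c rho_c delta : R) :
  0 < beta nu_p rho_c delta -> 0 < rho_p + nu_c - 1 / 4 ->
  exists2 ce : R * R, 0 < ce.2 & forall w y : 'cV[R]_(m + m),
  dot w (Rmx m nu_p nu_c *m w) + 2 * dot w (Smx m nu_p nu_c *m y) +
  dot y (Qmx m nu_p rho_p nu_c rho_c delta *m y) <=
  ce.1 * dot w w - ce.2 * dot y y.
Proof.
set b := beta _ _ _; set a := _ - 1 / 4 => b0 a0.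
(* Each output occurs in two of the four cross terms; spending [e] on each
   leaves [4 * e - 2 * e] of the dissipation. *)
pose e := Num.min a b / 4.
have e0 : 0 < e by rewrite divr_gt0// lt_min a0 b0.
have ea : 4 * e <= a by rewrite /e mulrC divfK ?ge_min ?lexx.
have eb : 4 * e <= b by rewrite /e mulrC divfK ?ge_min ?lexx ?orbT.
pose K := `|nu_p - `|nu_p| | + `|nu_c| +
  (1 ^+ 2 / e + (2 * nu_p) ^+ 2 / e + (- 2 * nu_c) ^+ 2 / e).
have X0 (x : R) : 0 <= x ^+ 2 / e by rewrite divr_ge0 ?sqr_ge0 ?ltW.
have X1 := X0 1; have X2 := X0 (2 * nu_p); have X3 := X0 (- 2 * nu_c).
have N1 := ler_norm (- (nu_p - `|nu_p|)); rewrite normrN in N1.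
have N2 := ler_norm (- nu_c); rewrite normrN in N2.
have N3 := normr_ge0 nu_c; have N4 := normr_ge0 (nu_p - `|nu_p|).
exists (K, 2 * e) => [|w y]; first by rewrite mulr_gt0.
rewrite loop_supplyE /= -/a -/b (dot_vsubmx w) (dot_vsubmx y).
move: (usubmx w) (dsubmx w) (usubmx y) (dsubmx y) => w1 w2 yp yc.
have Y1 := dot_young 1 w1 yp e0; have Y2 := dot_young (2 * nu_p) w1 yc e0.
have Y3 := dot_young (- 2 * nu_c) w2 yp e0; have Y4 := dot_young 1 w2 yc e0.
have W1 : (- (nu_p - `|nu_p|) + 1 ^+ 2 / e + (2 * nu_p) ^+ 2 / e) * dot w1 w1
    <= K * dot w1 w1.
  by rewrite ler_wpM2r ?dot_ge0// /K; lra.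
have W2 : (- nu_c + 1 ^+ 2 / e + (- 2 * nu_c) ^+ 2 / e) * dot w2 w2
    <= K * dot w2 w2.
  by rewrite ler_wpM2r ?dot_ge0// /K; lra.
have P1 : 4 * e * dot yp yp <= a * dot yp yp by rewrite ler_wpM2r ?dot_ge0.
have P2 : 4 * e * dot yc yc <= b * dot yc yc by rewrite ler_wpM2r ?dot_ge0.
move: W1 W2 Y1 Y2 Y3 Y4; rewrite !mulrDl; lra.
Qed.

(** * Right derivatives *)

Lemma is_rderiveD (f g : R -> R) (t l k : R) :
  is_rderive f t l -> is_rderive g t k -> is_rderive (f \+ g) t (l + k).
Proof.
move=> fl gk; rewrite /is_rderive.
under eq_fun do rewrite /= opprD addrACA scalerDr.
exact: cvgD fl gk.
Qed.

Lemma is_rderiveZ (f : R -> R) (a t l : R) :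
  is_rderive f t l -> is_rderive (fun s => a * f s) t (a * l).
Proof.
move=> fl; rewrite /is_rderive.
under eq_fun do rewrite -mulrBr scalerAr.
exact: cvgM (cvg_cst _) fl.
Qed.

Lemma is_rderive_id (t : R) : is_rderive id t (1 : R).
Proof.
apply: cvg_near_cst; near=> h.
rewrite addrAC subrr add0r; apply: mulVf; rewrite gt_eqF//.
Unshelve. all: by end_near. Qed.

Lemma is_rderive_lt (f : R -> R) (t l c : R) : is_rderive f t l -> l < c ->
  exists2 d : R, 0 < d & forall s, t < s < t + d -> f s - f t <= c * (s - t).
Proof.
move=> fl lc; have : \forall h \near 0^'+, h^-1 *: (f (t + h) - f t) < c.
  exact: (cvgr_lt _ fl).
move=> /nbhs_ballP[d /= d0 Hd]; exists d => // s /andP[ts sd].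
have st0 : 0 < s - t by rewrite subr_gt0.
have := Hd (s - t); rewrite subrKC => /(_ _ st0).
rewrite /ball/= sub0r normrN gtr0_norm// ltrBlDl => /(_ sd).
by rewrite /GRing.scale/= mulrC ltr_pdivrMr// => /ltW.
Qed.

(** * Integrating a bound on the right derivative *)

(** Half of the Vitali-Caratheodory theorem, with the lower semicontinuity of
    [h] replaced by what it is needed for. Cut [D] into the level sets [E k] on
    which [k * eta <= g < k.+1 * eta] and enclose each [E k] in an open set
    [U k] of nearly the same measure; [h] is the sum of the functions equal to
    [k.+1 * eta] on [U k]. *)
Lemma open_majorant (D : set R) (g : R -> R) (e : R) :
  measurable D -> (mu D < +oo)%E -> measurable_fun D g ->
  (forall t, D t -> 0 <= g t) -> 0 < e ->
  exists h : R -> \bar R,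
  [/\ measurable_fun [set: R] h, forall t, (0 <= h t)%E,
      forall t, D t ->
        exists2 c : R, g t < c & \forall s \near t, (c%:E <= h s)%E
    & (\int[mu]_(t in D) h t <= \int[mu]_(t in D) (g t)%:E + e%:E)%E].
Proof.
move=> mD Dfin mg g0 e0.
(* The mesh: rounding [g] up to a multiple of [eta] costs at most [e / 2]. *)
pose eta : R := e / 2 / (fine (mu D) + 1).
have muD1 : 0 < fine (mu D) + 1 by rewrite ltr_wpDl// fine_ge0.
have eta0 : 0 < eta by rewrite !divr_gt0.
pose E k := D `&` g @^-1` `[k%:R * eta, k.+1%:R * eta[%classic.
have mE k : measurable (E k) by apply: mg => //; exact: measurable_itv.
have ED k : E k `<=` D by move=> t [].
have Efin k : (mu (E k) < +oo)%E.
  apply: le_lt_trans Dfin; apply: le_measure.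
  - exact: mem_set (mE k).
  - exact: mem_set.
  - exact: ED.
have DE : D = \bigcup_k E k.
  apply/seteqP; split => [t Dt|t [k _ /ED]//].
  have /truncn_itv/andP[lo hi] : 0 <= g t / eta by rewrite divr_ge0 ?g0// ltW.
  exists (Num.truncn (g t / eta)) => //; split => //=.
  by rewrite in_itv/= -ler_pdivlMr// lo -ltr_pdivrMr.
have tE : trivIset setT E.
  apply/trivIsetP => i j _ _ ij; apply/seteqP; split => // t [[_ /=]].
  rewrite !in_itv/= => /andP[i1 i2] [_ /=]; rewrite in_itv/= => /andP[j1 j2].
  case/eqP: ij; apply/eqP; rewrite eqn_leq; apply/andP.
  split; rewrite -ltnS -(ltr_nat R) -(ltr_pM2r eta0).
    exact: le_lt_trans i1 j2.
  exact: le_lt_trans j1 i2.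
(* The excess measure allowed to [U k]: weighted by the value [k.+1 * eta], it
   contributes [e / 2] times a geometric series. *)
pose r k : R := (e / 2) / (2 ^ k.+1)%:R / (k.+1%:R * eta).
have r0 k : 0 < r k.
  by rewrite !divr_gt0 ?ltr0n ?expn_gt0 ?invr_gt0// mulr_gt0.
have /choice[U HU] : forall k, exists U : set R,
    [/\ open U, E k `<=` U & (mu (U `\` E k) < (r k)%:E)%E].
  by move=> k; exact: (lebesgue_regularity_outer (mE k) (Efin k) (r0 k)).
have mU k : measurable (U k) by apply: open_measurable; have [] := HU k.
pose h t : \bar R := (\sum_(0 <= k <oo) (k.+1%:R * eta * \1_(U k) t)%:E)%E.
have h0 k t : (0 <= (k.+1%:R * eta * \1_(U k) t)%:E)%E.
  by rewrite lee_fin indicE mulr_ge0 ?ler0n// mulr_ge0 ?ler0n// ltW.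
have mh k A : measurable_fun A (fun t => (k.+1%:R * eta * \1_(U k) t)%:E).
  apply/measurable_EFinP; exact: measurable_funM.
exists h; split.
- apply: (ge0_emeasurable_sum (P := predT)) => [k t _ _|k _]; first exact: h0.
  exact: mh.
- by move=> t; apply: nneseries_ge0 => k _ _; exact: h0.
- rewrite DE => t [k _ Ekt].
  exists (k.+1%:R * eta).
    by have [_ /=] := Ekt; rewrite in_itv/= => /andP[].
  have [oU EU _] := HU k.
  have : nbhs t (U k) by apply: open_nbhs_nbhs; split => //; exact: EU.
  apply: filterS => s Us.
  rewrite /h (nneseriesD1 (n := k))//.
  rewrite indicE mem_set// mulr1 leeDl//.
  by apply: nneseries_ge0 => i _ _; exact: h0.
rewrite integral_nneseries//; last by move=> k; exact: mh.
have meta : measurable_fun D (EFin \o (fun t => g t + eta)).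
  by apply/measurable_EFinP; exact: measurable_funD.
have geta0 t : D t -> 0 <= g t + eta by move=> Dt; rewrite addr_ge0 ?g0// ltW.
pose A k := (\int[mu]_(t in E k) (g t + eta)%:E)%E.
have term k : (\int[mu]_(t in D) (k.+1%:R * eta * \1_(U k) t)%:E <=
    A k + (e / 2 / (2 ^ k.+1)%:R)%:E)%E.
  have k0 : 0 < k.+1%:R * eta by rewrite mulr_gt0.
  under eq_integral do rewrite EFinM.
  rewrite ge0_integralZl//; last 2 first.
  - by apply/measurable_EFinP; apply: measurable_indic; exact: (mU k).
  - by rewrite lee_fin ltW.
  rewrite integral_indic//; last exact: (mU k).
  have UE : (mu (U k `&` D) <= mu (E k) + (r k)%:E)%E.
    have [_ EU /ltW UEr] := HU k.
    have mUE : measurable (U k `\` E k) by exact: measurableD (mU k) (mE k).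
    apply: (@le_trans _ _ (mu (E k `|` (U k `\` E k)))).
      rewrite setDE setUIr setUv setIT.
      apply: le_measure; [apply: mem_set|apply: mem_set|
        by move=> t [Ut _]; right].
        exact: measurableI (mU k) mD.
      exact: measurableU (mE k) (mU k).
    rewrite measureU; [by rewrite leeD2l|exact: (mE k)|exact: mUE|].
    by apply/seteqP; split => // t [Et [_ /(_ Et)]].
  apply: le_trans (lee_wpmul2l _ UE) _; first by rewrite lee_fin ltW.
  rewrite muleDr ?fin_num_adde_defl// -EFinM.
  have -> : k.+1%:R * eta * r k = e / 2 / (2 ^ k.+1)%:R.
    by rewrite /r mulrC divfK// gt_eqF.
  rewrite leeD2r// -integral_cst; last exact: (mE k).
  apply: ge0_le_integral.
  - exact: (mE k).
  - by move=> t _; rewrite lee_fin ltW.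
  - exact: measurable_cst.
  - exact: (measurable_funS mD (@ED k) meta).
  - move=> t [_ /=]; rewrite in_itv/= => /andP[lo _].
    by rewrite lee_fin mulrSr mulrDl mul1r lerD2r.
apply: (@le_trans _ _
  (\sum_(0 <= k <oo) (A k + (e / 2 / (2 ^ k.+1)%:R)%:E))%E).
  by apply: lee_nneseries => // k _ _; apply: integral_ge0 => t _; exact: h0.
have A0 k : (0 <= A k)%E.
  by apply: integral_ge0 => t /ED/geta0; rewrite lee_fin.
apply: le_trans (epsilon_trick _ A0 _) _; first by rewrite divr_ge0// ltW.
have -> : (\sum_(0 <= k <oo) A k
    = \int[mu]_(t in D) (g t + eta)%:E)%E.
  rewrite DE ge0_integral_bigcup//=.
  - by rewrite -DE.
  - by rewrite -DE => t Dt; rewrite lee_fin geta0.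
under eq_integral do rewrite EFinD.
rewrite ge0_integralD//; last 2 first.
- exact/measurable_EFinP.
- by move=> t _; rewrite lee_fin ltW.
have etaD : (eta%:E * mu D <= (e / 2)%:E)%E.
  rewrite -(@fineK _ (mu D)) ?ge0_fin_numE// -EFinM lee_fin.
  rewrite /eta mulrAC ler_pdivrMr// ler_pM2l ?divr_gt0//.
  by rewrite lerDl.
rewrite -addeA leeD2l// integral_cst// [e in leRHS]splitr EFinD leeD2r//.
Qed.

Lemma left_lower (f : R -> R) (a b c v : R) : {within `[a, b], continuous f} ->
  a < c <= b -> v < f c -> exists2 s, a <= s < c & v < f s.
Proof.
move=> cf /andP[ac cb] vc.
have ab := lt_le_trans ac cb.
have /(continuous_within_itvP _ ab)[ci _ cB] := cf.
have fc : f x @[x --> c^'-] --> f c.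
  move: cb; rewrite le_eqVlt => /predU1P[->//|cb].
  by apply: cvg_at_left_filter; apply: ci; rewrite in_itv/= ac cb.
have : \forall s \near c^'-, a < s /\ s < c /\ v < f s.
  near=> s; split; last split; near: s.
  - exact: nbhs_left_gt.
  - exact: nbhs_left_lt.
  - exact: (cvgr_gt _ fc).
move=> /filter_ex[s [as_ [sc vs]]].
by exists s => //; rewrite ltW.
Unshelve. all: by end_near. Qed.

(** Since [h] stays above [c > l] near [t], the increment of [f] just after [t]
    is at most that of the integral of [h]. The bound thus propagates to the
    right of every time, and it persists at left limits because [f] is
    continuous and the integral of [h] is nondecreasing. *)
Lemma le_integral_majorant (a b : R) (f : R -> R) (h : R -> \bar R) :
  a <= b -> {within `[a, b], continuous f} ->
  measurable_fun [set: R] h -> (forall t, 0 <= h t)%E ->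
  (\int[mu]_(t in `[a, b]) h t < +oo)%E ->
  (forall t, a <= t < b -> exists l c : R,
    [/\ is_rderive f t l, l < c & \forall s \near t, (c%:E <= h s)%E]) ->
  ((f b - f a)%:E <= \int[mu]_(t in `[a, b]) h t)%E.
Proof.
move=> ab cf mh h0 hfin df.
pose Phi t := (\int[mu]_(s in `[a, t]) h s)%E.
have mhS (D : set R) : measurable_fun D h by exact: measurable_funS mh.
have Phi_le s t : s <= t -> (Phi s <= Phi t)%E.
  move=> st; apply: ge0_subset_integral => //.
    exact: mhS.
  by move=> x /=; rewrite !in_itv/= => /andP[-> /le_trans->].
have Phi_fin t : t <= b -> Phi t \is a fin_num.
  move=> tb; rewrite ge0_fin_numE; last exact: integral_ge0.
  exact: le_lt_trans (Phi_le _ _ tb) hfin.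
(* [c] is the supremum of the times up to which the bound holds throughout;
   left continuity of [f] extends the bound to [c] itself. *)
pose P t := ((f t - f a)%:E <= Phi t)%E.
pose A := [set t | a <= t <= b /\ forall s, a <= s <= t -> P s].
have Pa : P a by rewrite /P subrr; exact: integral_ge0.
have Aa : A a.
  by split=> [|s]; rewrite ?lexx// => /le_anti <-.
have supA : has_sup A by split; [exists a|exists b => t [/andP[]]].
pose c := sup A.
have ac : a <= c by exact: ub_le_sup supA.2 _ Aa.
have cb : c <= b by apply: ge_sup => [|t [/andP[]//]]; exists a.
have Plt s : a <= s < c -> P s.
  move=> /andP[as_ sc].
  have cs0 : 0 < c - s by rewrite subr_gt0.
  have [u [_ Au]] := sup_adherent cs0 supA.
  by rewrite -/c subKr => su; apply: Au; rewrite as_ ltW.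
have Pc : P c.
  move: ac; rewrite le_eqVlt => /predU1P[<-//|ac].
  rewrite /P leNgt; apply/negP => Pc.
  rewrite -(fineK (Phi_fin _ cb)) lte_fin ltrBrDr in Pc.
  have [|s /andP[as_ sc]] := left_lower cf _ Pc; first by rewrite ac cb.
  rewrite -ltrBrDr -lte_fin fineK ?Phi_fin// => H.
  have /(lt_le_trans H) : P s by apply: Plt; rewrite as_ sc.
  by apply/negP; rewrite -leNgt Phi_le// ltW.
suff <- : c = b by [].
apply/eqP; rewrite eq_le cb leNgt; apply/negP => cltb.
have [|l [k [fl lk]]] := df c; first by rewrite ac cltb.
move=> /nbhs_ballP[d1 /= d10 hk].
have [d2 d20 fk] := is_rderive_lt fl lk.
(* If [c < b], the bound is carried past [c] by some [d > 0]: the increment of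
   [f] after [c] is at most [k] times the time, and [h >= k] there. *)
pose d := Num.min (Num.min d1 d2 / 2) (b - c).
have d0 : 0 < d by rewrite !lt_min divr_gt0 ?lt_min ?d10 ?d20// subr_gt0.
have dmin : d < Num.min d1 d2.
  rewrite gt_min ltr_pdivrMr// ltr_pMr ?lt_min ?d10 ?d20//.
  by rewrite (ltr_nat _ 1 2).
have : A (c + d).
  split.
    by rewrite (le_trans ac) ?lerDl ?(ltW d0)//= -lerBrDl ge_min lexx orbT.
  move=> s /andP[as_ sd]; have [sc|cs] := ltP s c.
    by apply: Plt; rewrite as_.
  move: cs; rewrite le_eqVlt => /predU1P[<-//|cs].
  have sd' : s - c < Num.min d1 d2 by rewrite (le_lt_trans _ dmin)// lerBlDl.
  rewrite lt_min in sd'; case/andP: sd' => sd1 sd2.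
  have int_cs : ((k * (s - c))%:E <= \int[mu]_(x in `]c, s]) h x)%E.
    have [k0|k0] := leP k 0.
      apply: (@le_trans _ _ 0%E); last exact: integral_ge0.
      by rewrite lee_fin mulr_le0_ge0// subr_ge0 ltW.
    have -> : ((k * (s - c))%:E = \int[mu]_(x in `]c, s]) cst k%:E x)%E.
      rewrite integral_cst//= lebesgue_measure_itv/= lte_fin cs.
      by rewrite -EFinD -EFinM.
    apply: ge0_le_integral => //.
    - by move=> x _; rewrite lee_fin ltW.
    - exact: mhS.
    - move=> x /=; rewrite in_itv/= => /andP[cx xs]; apply: hk.
      rewrite /ball/= distrC ger0_norm ?subr_ge0 ?(ltW cx)//.
      by rewrite (le_lt_trans _ sd1)// lerB.
  have Phi_s : (Phi s = \int[mu]_(x in `]c, s]) h x + Phi c)%E.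
    rewrite addeC -ge0_integral_setU//.
    - rewrite /Phi; congr (\int[mu]_(x in _) h x)%E.
      apply/seteqP; split => x /=.
        rewrite !in_itv/= => /andP[ax xs].
        by have [xc|cx] := leP x c; [left; rewrite ax|right].
      rewrite !in_itv/= => -[/andP[-> xc]|/andP[cx ->]].
        by rewrite (le_trans xc)// ltW.
      by rewrite (le_trans ac)// ltW.
    - exact: mhS.
    - apply/disj_setPS => x [/=]; rewrite !in_itv/= => /andP[_ xc] /andP[cx _].
      by rewrite ltNge xc in cx.
  have -> : P s = ((f s - f c)%:E + (f c - f a)%:E <= Phi s)%E.
    by rewrite /P -EFinD addrA subrK.
  rewrite Phi_s; apply: leeD => //; apply: le_trans int_cs.
  by rewrite lee_fin fk// cs -ltrBlDl.
move=> /(ub_le_sup supA.2); rewrite -/c.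
by rewrite gerDl leNgt d0.
Qed.

Lemma rderive_le_integral_ge0 (a b : R) (f g : R -> R) :
  a <= b -> {within `[a, b], continuous f} -> measurable_fun `[a, b] g ->
  (forall t, a <= t <= b -> 0 <= g t) ->
  (forall t, a <= t < b -> exists2 l : R, is_rderive f t l & l <= g t) ->
  ((f b - f a)%:E <= \int[mu]_(t in `[a, b]) (g t)%:E)%E.
Proof.
move=> ab cf mg g0 df.
have [gfin|] := ltP (\int[mu]_(t in `[a, b]) (g t)%:E)%E +oo%E; last first.
  by rewrite leye_eq => /eqP ->; exact: leey.
have abfin : (mu `[a, b] < +oo)%E.
  rewrite lebesgue_measure_itv/=; case: ifP => _; last exact: ltry.
  by rewrite -EFinD ltry.
apply/lee_addgt0Pr => e e0.
have [h [mh h0 gh hg]] := open_majorant (measurable_itv _) abfin mg g0 e0.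
apply: (le_trans _ hg); apply: le_integral_majorant => //.
  by apply: (le_lt_trans hg); rewrite lte_add_pinfty// ltry.
move=> t /andP[at_ tb]; have atb : a <= t < b by rewrite at_ tb.
have [l fl lg] := df t atb.
have [|c gc ch] := gh t; first by rewrite /= in_itv/= at_ ltW.
by exists l, c; split => //; exact: le_lt_trans gc.
Qed.

(** Only the positive part of [g] is assumed integrable: the conclusion
    excludes that the integral of [g] be [-oo]. *)
Lemma rderive_le_integral (a b : R) (f g : R -> R) :
  a <= b -> {within `[a, b], continuous f} -> measurable_fun `[a, b] g ->
  (\int[mu]_(t in `[a, b]) (Num.max (g t) 0)%:E < +oo)%E ->
  (forall t, a <= t < b -> exists2 l : R, is_rderive f t l & l <= g t) ->
  ((f b - f a)%:E <= \int[mu]_(t in `[a, b]) (g t)%:E)%E.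
Proof.
move=> ab cf mg pfin df.
pose D : set R := `[a, b]%classic.
have muD : mu D = (b - a)%:E.
  rewrite /D lebesgue_measure_itv/= lte_fin.
  by move: ab; rewrite le_eqVlt => /predU1P[->|->]; rewrite ?ltxx ?subrr.
have mD : measurable D by exact: measurable_itv.
pose p t := Num.max (g t) 0; pose q t := Num.max (- g t) 0.
pose qn (n : nat) t := Num.min (q t) n%:R.
have mp : measurable_fun D p by apply: measurable_maxr.
have mq : measurable_fun D q.
  by apply: measurable_maxr => //; exact: measurableT_comp.
have mqn n : measurable_fun D (qn n) by apply: measurable_minr.
have p0 t : 0 <= p t by rewrite le_max lexx orbT.
have q0 t : 0 <= q t by rewrite le_max lexx orbT.
have qn0 n t : 0 <= qn n t by rewrite le_min q0 ler0n.
have gpq t : g t = p t - q t.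
  rewrite /p /q; case: ltrgt0P => gt; rewrite /Num.max;
    by repeat case: ifP; lra.
have pfin' : (\int[mu]_(t in D) (p t)%:E)%E \is a fin_num.
  by rewrite ge0_fin_numE//; apply: integral_ge0 => t _; rewrite lee_fin.
(* On the truncated bound [p - qn n >= - n], adding [n * t] to [f] reduces to a
   nonnegative bound. *)
have bound n : (\int[mu]_(t in D) (qn n t)%:E <=
    \int[mu]_(t in D) (p t)%:E - (f b - f a)%:E)%E.
  have mnq : measurable_fun D (fun t => n%:R - qn n t).
    by apply: measurable_funB => //; exact: mqn.
  have nq0 t : 0 <= n%:R - qn n t by rewrite subr_ge0 ge_min lexx orbT.
  have cF : {within D, continuous (f \+ (fun t => n%:R * t))}.
    apply: within_continuousD => //.
    by apply: continuous_subspaceT => t; exact: mulrl_continuous.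
  have mG : measurable_fun D (fun t => p t + (n%:R - qn n t)).
    exact: measurable_funD.
  have dF t : a <= t < b -> exists2 l : R,
      is_rderive (f \+ (fun t => n%:R * t)) t l & l <= p t + (n%:R - qn n t).
    move=> /df[l fl lg]; exists (l + n%:R * 1).
      by apply: is_rderiveD => //; exact: is_rderiveZ (is_rderive_id t).
    have : qn n t <= q t by rewrite ge_min lexx.
    by move: lg; rewrite gpq; lra.
  have G0 t (_ : a <= t <= b) := addr_ge0 (p0 t) (nq0 t).
  have := rderive_le_integral_ge0 ab cF mG G0 dF.
  under eq_integral do rewrite EFinD.
  rewrite ge0_integralD//; first last.
  - exact/measurable_EFinP.
  - by move=> t _; rewrite lee_fin.
  - exact/measurable_EFinP.
  - by move=> t _; rewrite lee_fin.
  have cst_n : (\int[mu]_(t in D) (n%:R - qn n t)%:E +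
      \int[mu]_(t in D) (qn n t)%:E = (n%:R * (b - a))%:E)%E.
    rewrite -ge0_integralD//; first last.
    - apply/measurable_EFinP; exact: mqn.
    - by move=> t _; rewrite lee_fin.
    - exact/measurable_EFinP.
    - by move=> t _; rewrite lee_fin.
    under eq_integral do rewrite -EFinD subrK.
    by rewrite integral_cst// EFinM; congr (_ * _)%E; exact: muD.
  move: cst_n; rewrite -(fineK pfin').
  have : (0 <= \int[mu]_(t in D) (qn n t)%:E)%E.
    by apply: integral_ge0 => t _; rewrite lee_fin.
  have : (0 <= \int[mu]_(t in D) (n%:R - qn n t)%:E)%E.
    by apply: integral_ge0 => t _; rewrite lee_fin.
  case: (\int[mu]_(t in D) (n%:R - qn n t)%:E)%E => [x| |] //=;
    case: (\int[mu]_(t in D) (qn n t)%:E)%E => [y| |] //=.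
  rewrite -EFinD => _ _ [xy]; rewrite -!EFinD !lee_fin; lra.
have lim : (\int[mu]_(t in D) (qn n t)%:E @[n --> \oo] -->
    \int[mu]_(t in D) (q t)%:E)%E.
  have -> : (\int[mu]_(t in D) (q t)%:E =
      \int[mu]_(t in D) limn (fun n => (qn n t)%:E))%E.
    apply: eq_integral => t _; apply/esym/lim_near_cst => //; near=> n.
    by congr (_%:E); apply/min_idPl; near: n; exact: nbhs_infty_ger.
  apply: cvg_monotone_convergence => //.
  - by move=> n; apply/measurable_EFinP; exact: mqn.
  - by move=> n t _; rewrite lee_fin.
  - move=> t _ n m nm; rewrite lee_fin le_min ge_min lexx/=.
    by rewrite (le_trans (y := n%:R)) ?ler_nat// ge_min lexx orbT.
(* Letting [n] grow shows that the negative part is integrable, which rules out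
   that [g] has integral [-oo]. *)
have le_q : (\int[mu]_(t in D) (q t)%:E <=
    \int[mu]_(t in D) (p t)%:E - (f b - f a)%:E)%E.
  rewrite -(cvg_lim _ lim)//; apply: lime_le; last exact: nearW.
  by apply/cvg_ex; eexists; exact: lim.
have q0int : (0 <= \int[mu]_(t in D) (q t)%:E)%E.
  by apply: integral_ge0 => t _; rewrite lee_fin.
rewrite integralE.
rewrite (_ : \int[mu]_(t in _) _ = \int[mu]_(t in D) (p t)%:E)%E; last first.
  by apply: eq_integral => t _; rewrite funeposE -EFin_max.
rewrite (_ : \int[mu]_(t in _) _^\- _ =
    \int[mu]_(t in D) (q t)%:E)%E; last first.
  by apply: eq_integral => t _; rewrite funenegE -EFinN -EFin_max.
move: le_q q0int; rewrite -(fineK pfin').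
case: (\int[mu]_(t in D) (q t)%:E)%E => [r| |] //=.
by rewrite -EFinB !lee_fin; lra.
Unshelve. all: by end_near. Qed.

(** * Finite gain L2 stability from a strict supply rate *)

Lemma measurable_span_co (T : \bar R) : measurable (span_co 0 T).
Proof.
case: T => [r| |].
- have -> : span_co 0 r%:E = `[0, r[%classic.
    by apply/seteqP; split=> t; rewrite /span_co/= in_itv/= lte_fin => /andP.
  exact: measurable_itv.
- have -> : span_co 0 +oo%E = `[(0 : R), +oo[%classic.
    apply/seteqP; split=> t; rewrite /span_co/= in_itv/= andbT ltry.
      by case.
    by split.
  exact: measurable_itv.
- have -> : span_co 0 -oo%E = set0 :> set R by apply/seteqP; split=> t [].
  exact: measurable0.
Qed.

Lemma measurable_dot q (D : set R) (w : R -> 'cV[R]_q) :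
  measurable_signal D w -> measurable_fun D (fun t => dot (w t) (w t)).
Proof.
move=> mw; under eq_fun do rewrite dotE.
by apply: measurable_sum => i; exact: measurable_funM.
Qed.

(** The storage divided by [eps] witnesses the stability. Continuity along the
    trajectories has to be asked for, since a right derivative does not exclude
    jumps from the left. *)
Lemma L2_stable_of_supply q n p (G : io_system R q n p) supply V (c eps : R) :
  0 < eps -> dissipative_with G supply V ->
  (forall T w x y, trajectory G T w x y ->
     {within span_co 0 T, continuous (V \o x)}) ->
  (forall w y, supply w y <= c * dot w w - eps * dot y y) ->
  L2_stable G.
Proof.
move=> eps0 [VG dVG] cV sup.
(* [gamma ^+ 2 >= c / eps] without a square root. *)
pose gamma := 1 + `|c| / eps.
have gamma0 : 0 < gamma by rewrite ltr_pwDl// divr_ge0// ltW.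
have cg : eps^-1 * c <= gamma ^+ 2.
  have : eps^-1 * c <= `|c| / eps.
    by rewrite mulrC ler_pM2r ?invr_gt0// ler_norm.
  have : 0 <= `|c| / eps by rewrite divr_ge0// ltW.
  by rewrite /gamma; nra.
exists (fun x => eps^-1 * V x), gamma; split=> // [x /VG[V0 _]|].
  by rewrite mulr_ge0// invr_ge0 ltW.
move=> T w x y traj mw my t1 t10 t1T intw.
pose g t := gamma ^+ 2 * dot (w t) (w t) - dot (y t) (y t).
have sub : `[0, t1]%classic `<=` span_co 0 T.
  move=> t /=; rewrite in_itv/= => /andP[t0 tt1]; split => //.
  by rewrite (le_lt_trans _ t1T)// lee_fin.
have mS (f : R -> R) :
    measurable_fun (span_co 0 T) f -> measurable_fun `[0, t1] f.
  by apply: measurable_funS => //; exact: measurable_span_co.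
have mW := mS _ (measurable_dot mw); have mY := mS _ (measurable_dot my).
apply: (@rderive_le_integral 0 t1 (fun t => eps^-1 * (V (x t))) g).
- exact: ltW.
- apply: (continuous_subspaceW sub) => t.
  by apply: cvgM; [exact: cvg_cst|exact: cV traj t].
- by apply: measurable_funB => //; exact: measurable_funM.
- have mgW : measurable_fun `[0, t1] (fun t => gamma ^+ 2 * dot (w t) (w t)).
    by apply: measurable_funM; [exact: measurable_cst|exact: mW].
  have mg : measurable_fun `[0, t1] g by exact: measurable_funB.
  have gw0 t : 0 <= gamma ^+ 2 * dot (w t) (w t).
    by rewrite mulr_ge0 ?sqr_ge0 ?dot_ge0.
  have : (\int[mu]_(t in `[0%R, t1])
      (gamma ^+ 2 * dot (w t) (w t))%:E < +oo)%E.
    under eq_integral do rewrite EFinM.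
    rewrite integralZl// lte_mul_pinfty ?lee_fin ?sqr_ge0//.
    exact: integrable_lty intw.
  apply: le_lt_trans; apply: ge0_le_integral => //.
  + by move=> t _; rewrite lee_fin le_max lexx orbT.
  + by apply/measurable_EFinP; exact: measurable_maxr.
  + by apply/measurable_EFinP.
  + by move=> t _; rewrite lee_fin ge_max gw0 andbT /g lerBlDr lerDl dot_ge0.
- move=> t /andP[t0 tt1].
  have tT : span_co 0 T t by apply: sub; rewrite /= in_itv/= t0 ltW.
  have [dV dVt dVle] := dVG _ _ _ _ traj t tT.
  exists (eps^-1 * dV); first exact: is_rderiveZ.
  have := le_trans dVle (sup _ _).
  rewrite -(ler_pM2l (x := eps^-1)) ?invr_gt0// => /le_trans; apply.
  rewrite mulrBr !mulrA mulVf ?gt_eqF// mul1r lerB// ler_wpM2r// dot_ge0//.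
Qed.

(** * The event-triggered loop *)

(** Each time is at or after some [tk k] and before [tk k.+1], the infimum of
    the triggering times, so that the triggering condition fails there; up to
    [tk k.+1] the continuation of the loop by which that event is defined agrees
    with the actual trajectory. *)
Lemma held_sample_error np nc m (delta : R) (Gp : system R np m)
    (Gc : system R nc m) (T : \bar R) w1 w2 xp xc yp yc :
  event_triggered_solution delta Gp Gc T w1 w2 xp xc yp yc ->
  exists up uc, [/\ solution Gp 0 T up xp yp, solution Gc 0 T uc xc yc &
    forall t, span_co 0 T t -> exists e,
      [/\ dot e e <= delta * dot (yc t) (yc t), up t = w1 t + e - yc t &
          uc t = w2 t + yp t]].
Proof.
move=> [tk [up [uc [tk0 tk_nd tk_cover [solp solc] tk_event]]]].
exists up, uc; split=> // t [t0 tT].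
have [k /andP[tkt ttk]] := tk_cover t (conj t0 tT).
have : (0 <= tk k)%E by rewrite -tk0 tk_nd.
case tkE : (tk k) tkt => [a| |] //; rewrite lee_fin => at_ _.
have aT : (a%:E < T)%E by rewrite (le_lt_trans _ tT)// lee_fin.
have [inputs [b [xp' [xc' [yp' [yc' [_ sb agree sE]]]]]]] :=
  tk_event k a tkE aT.
have ts : span_co a (Order.min T (tk k.+1)) t by split=> //; rewrite lt_min tT.
have [-> ->] := inputs t ts.
exists (yc t - yc a); split => //; last by rewrite -addrA (addrC (_ - _)) addKr.
have [_ _ _ yc't] := agree t ts.
rewrite -!norm2_sqr leNgt; apply/negP => trigger.
(* A time before the next event at which the bound fails would itself be an
   event. *)
have : (tk k.+1 <= t%:E)%E.
  rewrite sE; apply: ereal_inf_lbound; exists t => //.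
  split; last by rewrite yc't.
  by split=> //; exact: (lt_le_trans ts.2).
by rewrite leNgt ttk.
Qed.

Lemma usubmx_differentiable n1 n2 (x : 'cV[R]_(n1 + n2)) :
  differentiable (usubmx : 'cV[R]_(n1 + n2) -> 'cV[R]_n1) x.
Proof.
apply: linear_differentiable => y s /nbhs_ballP[e /= e0 es].
apply/nbhs_ballP; exists e => // z [_ yz].
by apply: es; split => // i j; rewrite !mxE; exact: yz.
Qed.

Lemma dsubmx_differentiable n1 n2 (x : 'cV[R]_(n1 + n2)) :
  differentiable (dsubmx : 'cV[R]_(n1 + n2) -> 'cV[R]_n2) x.
Proof.
apply: linear_differentiable => y s /nbhs_ballP[e /= e0 es].
apply/nbhs_ballP; exists e => // z [_ yz].
by apply: es; split => // i j; rewrite !mxE; exact: yz.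
Qed.

Lemma storage_continuous n m (G : system R n m) V T u x y :
  storage (io_of G) V -> solution G 0 T u x y ->
  {within span_co 0 T, continuous (V \o x)}.
Proof.
move=> HV [cx Hx]; rewrite continuous_subspace_in => t tD.
apply: (@continuous_comp (subspace (span_co 0 T)) _ _ x V t).
  exact: cx.
apply: differentiable_continuous; apply: (HV _ _).2.
by have [] := Hx t (set_mem tD).
Qed.

End passive_loop.

Theorem theorem6 (R : realType) (np nc m : nat)
    (Gp : system R np m) (Gc : system R nc m)
    (nu_p rho_p nu_c rho_c delta : R) (m_gt0 : (0 < m)%N)
    (HGp : IF_OFP nu_p rho_p (io_of Gp)) (HGc : IF_OFP nu_c rho_c (io_of Gc))
    (delta_gt0 : 0 < delta) (delta_le1 : delta <= 1) :
  let G := event_triggered_loop delta Gp Gc in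
  let Q := Qmx m nu_p rho_p nu_c rho_c delta in
  let S := Smx m nu_p nu_c in
  let W := Rmx m nu_p nu_c in
  [/\ QSR_dissipative Q S^T W G,
      exists V, dissipative_with G
        (fun w y => dot w (W *m w) + 2 * dot w (S *m y) + dot y (Q *m y)) V,
      negdef Q <-> (0 < beta nu_p rho_c delta /\ 0 < rho_p + nu_c - 1 / 4)
    & negdef Q -> L2_stable G].
Proof.
move=> G Q S W.
have [Vp dVp] := HGp; have [Vc dVc] := HGc.
pose V (z : 'cV[R]_(np + nc)) := Vp (usubmx z) + Vc (dsubmx z).
have dV : dissipative_with G
    (fun w y => dot w (W *m w) + 2 * dot w (S *m y) + dot y (Q *m y)) V.
  split=> [z [zp zc]|T w z y traj t tT].
    have [Vp0 dp] := dVp.1 _ zp; have [Vc0 dc] := dVc.1 _ zc.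
    split; first by rewrite /V addr_ge0.
    apply: differentiableD.
      exact: (differentiable_comp (usubmx_differentiable z) dp).
    exact: (differentiable_comp (dsubmx_differentiable z) dc).
  have [up [uc [solp solc /(_ t tT)[e [ee upE ucE]]]]] :=
    held_sample_error traj.
  have [dp dpV dpS] := dVp.2 _ _ _ _ solp t tT.
  have [dc dcV dcS] := dVc.2 _ _ _ _ solc t tT.
  exists (dp + dc); first exact: (is_rderiveD dpV dcV).
  rewrite (le_trans (lerD dpS dcS))// upE ucE loop_supplyE /=.
  exact: loop_supply_le.
split.
- split; try by rewrite /Q /W tr_block_mx !tr_scalar_mx !trmx0.
  exists V; split=> [|T w z y traj t tT]; first exact: dV.1.
  have [l lV le_l] := dV.2 _ _ _ _ traj t tT; exists l => //.
  by rewrite (le_trans le_l)// dot_trmx -/Q; lra.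
- by exists V.
- exact: negdef_Qmx.
move=> /(negdef_Qmx _ _ _ _ _ m_gt0)[b0 a0].
have [[c eps] /= eps0 sup] := loop_supply_strict m b0 a0.
apply: (L2_stable_of_supply eps0 dV) => // T w z y traj.
have [up [uc [solp solc _]]] := held_sample_error traj.
apply: within_continuousD.
  exact: storage_continuous dVp.1 solp.
exact: storage_continuous dVc.1 solc.
Qed.
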